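(* There exists a binary linear code of length $108$, dimension $23$ and minimum distance $36$. *)

(* Defs.v *)
(* Binary linear codes of length n are subspaces of 'F_2^n,
   represented (mxalgebra style) by a matrix whose row space is the code. *)
From mathcomp Require Import all_boot all_order all_algebra.
Set Implicit Arguments. Unset Strict Implicit. Unset Printing Implicit Defensive.
Import GRing.Theory.
Local Open Scope ring_scope.

Definition hamming_dist (n : nat) (x y : 'rV['F_2]_n) : nat :=
  #|[set i : 'I_n | x 0 i != y 0 i]|.

Definition is_binary_linear_code (n k d : nat) (C : 'M['F_2]_n) : Prop :=
  \rank C = k /\
  (forall x y : 'rV['F_2]_n, (x <= C)%MS -> (y <= C)%MS -> x != y ->
     (d <= hamming_dist x y)%N) /\
  (exists x y : 'rV['F_2]_n, [/\ (x <= C)%MS, (y <= C)%MS, x != y &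
     hamming_dist x y = d]).
Arguments is_binary_linear_code n k d C : clear implicits.

(* Main.v *)
(** Order the 108 coordinates as 27 columns of 4.  The code is invariant under
    the cyclic shift of the columns, so it corresponds to a module over
    F_2[X]/(X^27 - 1); it is the sum of
    - a component over F_(2^18) = F_2[X]/(X^18 + X^9 + 1), of dimension 1 and
      hence of binary dimension 18, spanned by (1, a, b, c) with
      1 + N a + N b + N c = 0 for the norm N to F_(2^9);
    - the F_4-component spanned by (1, 1, 0, 0) and (0, 0, 1, 1), of binary
      dimension 4;
    - the all-one word.
    The norm condition makes the code doubly even; a, b, c were found by a
    random search.

    For the minimum distance, consider a word of weight W <= 35.  By the cycle
    lemma some rotation of its columns has weight at most W l / 27 in its first
    l columns, for every l.  As the first 24 bits (6 columns) determine a
    codeword, a depth-first search over the words obeying these prefix bounds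
    visits less than 2 10^6 nodes, and it only finds the zero word. *)
From Stdlib Require Import BinPosDef.
Require Import Defs.
From mathcomp Require Import all_boot all_order all_algebra.
From mathcomp Require Import zify.
Set Implicit Arguments. Unset Strict Implicit. Unset Printing Implicit Defensive.
Import GRing.Theory.

(** * Basis words and systematic encoding *)

Fixpoint pos_bits (p : positive) : seq bool :=
  match p with
  | xH => [:: true]
  | xO q => false :: pos_bits q
  | xI q => true :: pos_bits q
  end.

(* Entry [k] is the basis word with leading 1 in coordinate [k], stored from
   coordinate [k] on without its trailing zeros (little-endian in the
   hexadecimal literal), or [::] if there is none.  The basis is in reduced
   echelon form, so [encode] below is systematic: a codeword is its own
   message. *)
Definition generators : seq (seq bool) := Eval vm_compute in
  [seq pos_bits p | p <- [::
    0x81c8fd3f393180d3021dd000001; 0x70c59429d7ffff5afd892200001;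
    0x232e5d25298d86ed6048c900001; 0x60f0f9b195a611e2eea4e80001;
    0x2cf7af2b59cb05c1568f740001; 0x22fc52929e7283575e23aa0001;
    0x3efbcd64aa6cacea59580d0001; 0xcf8831c077fde2e31851a8001;
    0x2ef1dae6334fa2a093e504001; 0x69999363b43338af22ab32001;
    0x189c6102984015ed165f61001; 0x22e7a5896c4de43171784001;
    0xe9686309b05d4bcc5420401; 0x71dcc82e9d9c339d0856001;
    0x128a8718467327917b7a4801; 0x12deba2e8b6bd42b113bfa01;
    0xe9686309b05d4bcc5420401; 0x71dcc82e9d9c339d0856001;
    0xb862ca14ebffffad7ec491; 0x1bddb2d448c113b55d16549;
    0xcbcc1084c6ce51344f6715; 0x336992e6384e4f2803d18b]%positive]
  ++ [::] :: pos_bits 0x1a7a13eae6aba9272fe8d9%positive :: nseq 84 [::].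

Fixpoint xors (s t : seq bool) : seq bool :=
  match s, t with
  | a :: s', b :: t' => (a (+) b) :: xors s' t'
  | [::], _ => t
  | _, [::] => s
  end.

Lemma nth_xors s t j :
  nth false (xors s t) j = nth false s j (+) nth false t j.
Proof.
by elim: s t j => [|a s IH] [|b t] [|j] //=; rewrite ?addbF.
Qed.

(** [acc] carries what the rows already used contribute to the coordinates still to come, so the
    word is emitted bit by bit, in step with [search]. *)
Fixpoint encode (rows : seq (seq bool)) (m acc : seq bool) : seq bool :=
  if rows is r :: rows' then
    let acc' := if head false m then xors acc r else acc in
    head false acc' :: encode rows' (behead m) (behead acc')
  else [::].

Lemma size_encode rows m acc : size (encode rows m acc) = size rows.
Proof. by elim: rows m acc => //= r rows IH m acc; rewrite IH. Qed.

Lemma nth_encode rows m acc j : j < size rows ->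
  nth false (encode rows m acc) j = nth false acc j (+)
    \big[addb/false]_(i < size rows)
      (nth false m i && ((i <= j) && nth false (nth [::] rows i) (j - i))).
Proof.
elim: rows m acc j => //= r rows IH m acc j ltj.
set acc' := if _ then _ else _.
have nth_acc' k : nth false acc' k =
    nth false acc k (+) (nth false m 0 && nth false r k).
  by rewrite /acc' nth0; case: (head _ _); rewrite ?nth_xors ?addbF.
rewrite big_ord_recl /= subn0 addbA -nth_acc'.
case: j ltj => [|j] ltj /=.
  by rewrite big1 ?addbF ?nth0 // => i _; rewrite /= andbF.
by rewrite IH // nth_behead; congr (_ (+) _);
  apply: eq_bigr => i _; rewrite nth_behead.
Qed.

(** * Depth-first search under prefix bounds *)

Fixpoint within (gains : seq nat) (s : seq bool) (k : nat) : bool :=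
  if (gains, s) is (g :: gains', b :: s') then
    (b <= g + k) && within gains' s' (g + k - b)
  else true.

Lemma within_prefix gains s k :
  (forall p, p < size s -> count id (take p.+1 s) <= k + sumn (take p.+1 gains)) ->
  within gains s k.
Proof.
elim: gains s k => [|g gains IH] [|b s] k //= H.
have Hb : b <= g + k by have := H 0 isT; rewrite /= !take0 /= ; lia.
rewrite Hb; apply: IH => p ltp; have /= := H p.+1 ltp; lia.
Qed.

(* [k] is the number of further ones that the prefix bounds allow at this point.
   An exhausted branch must end with [k = budget]: with [budget] equal to the
   sum of the gains, this says that no one occurred in the word. *)
Fixpoint search (budget : nat) (gains : seq nat) (rows : seq (seq bool))
    (acc : seq bool) (k : nat) : bool :=
  if gains is g :: gains' then
    let k' := g + k in
    let next a :=
      if head false a then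
        if k' is k''.+1 then search budget gains' (behead rows) (behead a) k'' else true
      else search budget gains' (behead rows) (behead a) k' in
    if head [::] rows is b :: r then next acc && next (xors acc (b :: r)) else next acc
  else k == budget.

(** The two calls of [next] are the two values of the message bit; at an empty row the bit changes
    nothing, so one call covers both. A one met with no allowance left contradicts [within]. *)
Lemma searchP budget gains rows acc k m :
  size gains = size rows -> search budget gains rows acc k ->
  within gains (encode rows m acc) k ->
  count id (encode rows m acc) + budget = k + sumn gains.
Proof.
elim: gains rows acc k m => [|g gains IH] [|r rows] acc k m //=.
  by move=> _ /eqP->; rewrite addn0.
case=> eqs.
pose next a := if head false a then
    if g + k is k''.+1 then search budget gains rows (behead a) k'' else true
  else search budget gains rows (behead a) (g + k).
have nextP a : next a ->
    (head false a <= g + k) &&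
      within gains (encode rows (behead m) (behead a)) (g + k - head false a) ->
    head false a + count id (encode rows (behead m) (behead a)) + budget =
      k + (g + sumn gains).
  rewrite /next; case: (head false a) => [|] /=.
    case Ek: (g + k) => [|k'] //.
    by move=> S /andP[_]; rewrite subn1 => /IH -/(_ eqs S); lia.
  by move=> S; rewrite subn0 => /IH -/(_ eqs S); lia.
case: r => [|b r] /=.
  have -> : (if head false m then xors acc [::] else acc) = acc.
    by case: (head _ m) => //; case: (acc).
  exact: nextP.
by move=> /andP[N0 N1]; case: (head false m); [apply: (nextP _ N1)|apply: (nextP _ N0)].
Qed.

(** * Light rotations *)

(* The cycle lemma: start right after the prefix [r] maximising
   [n * weight of the prefix - total weight * r]. *)
Lemma light_rotation (T : Type) (a : pred T) n w (s : seq T) : size s = w * n ->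
  exists2 r, r <= n & forall l, l <= n ->
    n * count a (take (w * l) (rot (w * r) s)) <= count a s * l.
Proof.
move=> ss; set W := count a s.
pose F r := count a (take (w * r) s).
(* Adding the constant [W * n] to the maximised quantity keeps it a natural number. *)
pose f (r : 'I_n.+1) := n * F r + W * (n - r).
case: (@arg_maxnP _ (@ord0 n) xpredT f isT) => r _ fmax.
have le_rn : r <= n by rewrite -ltnS.
have lewr : w * r <= size s by rewrite ss leq_mul2l le_rn orbT.
exists r => // l le_ln.
have Fmax q : q <= n -> n * F q + W * (n - q) <= n * F r + W * (n - r).
  by rewrite -ltnS => lt_qn; have := fmax (Ordinal lt_qn) isT.
have cdrop : F r + count a (drop (w * r) s) = W.
  by rewrite /F -count_cat cat_take_drop.
rewrite /rot take_cat size_drop ss -mulnBr.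
have [le_l|lt_l] := leqP (r + l) n.
  have := Fmax _ le_l.
  have -> : F (r + l) = F r + count a (take (w * l) (drop (w * r) s)).
    by rewrite /F -count_cat mulnDr takeD.
  have -> : count a (if w * l < w * (n - r) then take (w * l) (drop (w * r) s)
      else drop (w * r) s ++ take (w * l - w * (n - r)) (take (w * r) s)) =
      count a (take (w * l) (drop (w * r) s)).
    case: ltnP => // le_w; have -> : w * l - w * (n - r) = 0.
      by apply/eqP; rewrite subn_eq0 leq_mul2l; apply/orP; right; lia.
    by rewrite take0 cats0 take_oversize // size_drop ss -mulnBr.
  move: (count a _) (F r) => c Fr.
  have -> : n - r = n - (r + l) + l by lia.
  rewrite !mulnDr; lia.
(* Here the window wraps around: it is the suffix after the start, followed by the first [r + l - n]
   columns. *)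
have le_q : r + l - n <= n by lia.
have := Fmax _ le_q.
have -> : (w * l < w * (n - r)) = false.
  by apply/negbTE; rewrite -leqNgt leq_mul2l; apply/orP; right; lia.
rewrite count_cat -mulnBr take_takel; last first.
  by rewrite leq_mul2l; apply/orP; right; lia.
have -> : l - (n - r) = r + l - n by lia.
rewrite -/(F (r + l - n)).
move: cdrop; move: (count a _) (F _) (F r) => c Fq Fr cdrop Hmax.
set q := r + l - n in le_q Hmax *.
have lE : W * l = W * (n - r) + W * q by rewrite -mulnDr; congr (_ * _); lia.
have WnE : n * Fr + n * c = W * (n - q) + W * q.
  by rewrite -!mulnDr cdrop subnK // mulnC.
rewrite mulnDr lE; lia.
Qed.

(** Each increment of [(35 * l) %/ 27] is granted at the first bit of its column, so a prefix ending
    inside a column gets the bound of the completed column. *)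
Definition gains : seq nat := Eval vm_compute in
  flatten [seq [:: (35 * l.+1) %/ 27 - (35 * l) %/ 27; 0; 0; 0] | l <- iota 0 27].

Lemma sumn_gains p : p < 108 -> (35 * (p %/ 4).+1) %/ 27 <= sumn (take p.+1 gains).
Proof.
move=> ltp.
have : all (fun p => (35 * (p %/ 4).+1) %/ 27 <= sumn (take p.+1 gains))
    (iota 0 108) by vm_compute.
by move=> /allP; apply; rewrite mem_iota.
Qed.

Lemma within_light_rotation s : size s = 108 -> count id s <= 35 ->
  exists2 r, r <= 27 & within gains (rot (4 * r) s) 0.
Proof.
move=> ss light; have [r le_r lightr] := @light_rotation _ id 27 4 s ss.
exists r => //; apply: within_prefix => p; rewrite size_rot ss => ltp.
rewrite add0n (leq_trans _ (sumn_gains ltp)) //.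
have le27 : (p %/ 4).+1 <= 27 by lia.
rewrite leq_divRL // mulnC.
apply: leq_trans (leq_trans (lightr _ le27) _); last by rewrite leq_mul2r light orbT.
rewrite leq_mul2l /= -[X in _ <= count _ (take X _)](subnKC (_ : p.+1 <= _)); last first.
  by lia.
by rewrite takeD count_cat leq_addr.
Qed.

Lemma search_generators : search 35 gains generators [::] 0.
Proof. by vm_compute. Qed.

Local Open Scope ring_scope.

(** * Words over the two-element field as bit lists *)

Section Bits.
Variable n : nat.
Implicit Types x y : 'rV['F_2]_n.

Definition bits x : seq bool := [seq x 0 i != 0 | i <- enum 'I_n].
Definition vec (s : seq bool) : 'rV['F_2]_n := \row_j (nth false s j)%:R.

Lemma size_bits x : size (bits x) = n.
Proof. by rewrite size_map size_enum_ord. Qed.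

Lemma nth_bits x (i : 'I_n) : nth false (bits x) i = (x 0 i != 0).
Proof. by rewrite (nth_map i) ?size_enum_ord // nth_ord_enum. Qed.

Lemma F2_neq0K (a : 'F_2) : (a != 0)%:R = a.
Proof. by case: a => [[|[|m]] ?] //; apply: val_inj. Qed.

Lemma F2_natr_neq0 (b : bool) : (b%:R != 0 :> 'F_2) = b.
Proof. by case: b. Qed.

Lemma F2_neq0D (a b : 'F_2) : (a + b != 0) = (a != 0) (+) (b != 0).
Proof. by rewrite -[a]F2_neq0K -[b]F2_neq0K; case: (a != 0); case: (b != 0). Qed.

Lemma F2_neq0_sum (I : finType) (F : I -> 'F_2) :
  (\sum_i F i != 0) = \big[addb/false]_i (F i != 0).
Proof. by apply: (big_morph (fun a => a != 0)) => [a b|]; rewrite ?F2_neq0D ?eqxx. Qed.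

Lemma bitsK : cancel bits vec.
Proof. by move=> x; apply/rowP=> i; rewrite mxE nth_bits F2_neq0K. Qed.

Lemma vecK s : size s = n -> bits (vec s) = s.
Proof.
move=> ss; apply: (@eq_from_nth _ false) => [|i]; first by rewrite size_bits.
by rewrite size_bits => lti; rewrite (nth_bits _ (Ordinal lti)) mxE F2_natr_neq0.
Qed.

Lemma hamming_distE x y : hamming_dist x y = count id (bits (x - y)).
Proof.
rewrite /hamming_dist cardE /bits count_map -size_filter enumT /enum_mem.
by congr size; apply: eq_filter => i; rewrite /= inE !mxE subr_eq0.
Qed.

End Bits.

(** * The code, its dimension and its cyclic symmetry *)

Definition code : 'M['F_2]_108 :=
  \matrix_(i, j) [&& i <= j & nth false (nth [::] generators i) (j - i)]%N%:R.

Lemma bits_code (u : 'rV['F_2]_108) :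
  bits (u *m code) = encode generators (bits u) [::].
Proof.
apply: (@eq_from_nth _ false) => [|j]; first by rewrite size_encode size_bits.
rewrite size_bits => ltj; rewrite nth_encode // nth_nil addFb.
rewrite (nth_bits _ (Ordinal ltj)) mxE F2_neq0_sum; apply: eq_bigr => i _.
rewrite mxE nth_bits /=; case: (_ && _); last by rewrite mulr0 eqxx andbF.
by rewrite mulr1 andbT.
Qed.

Lemma rank_code : \rank code = 23.
Proof.
(* The leading coordinates of the basis words are 0 to 21 and 23; all other rows of [code]
   vanish. *)
have [piv pivE] : exists piv : 'I_23 -> 'I_108,
    forall i, piv i = (if i == 22 :> nat then 23 else i)%N :> nat.
  exists (fun i => inord (if i == 22 :> nat then 23 else i)%N) => i.
  by rewrite inordK //; case: ifP => // _; have := ltn_ord i; lia.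
pose G := rowsub piv code.
have -> : \rank code = \rank G.
  apply/eqP; rewrite eqn_leq !mxrankS ?rowsub_sub //.
  apply/row_subP => i.
  have [j eqj|nopiv] := pickP (fun j => piv j == i).
    by rewrite -(eqP eqj) -row_rowsub row_sub.
  have -> : row i code = 0; last exact: sub0mx.
  apply/rowP => j; rewrite !mxE.
  suff -> : nth [::] generators i = [::] by rewrite nth_nil andbF.
  have : all (fun k => [|| k < 22, k == 23 | nth [::] generators k == [::]])%N
    (iota 0 108) by vm_compute.
  move=> /allP /(_ i); rewrite mem_iota ltn_ord => /(_ isT).
  case: ltnP => [lti|_] /=.
    have lti' : (i < 23)%N by apply: ltn_trans lti _.
    have := nopiv (Ordinal lti'); rewrite -val_eqE /= pivE /=.
    by rewrite (ltn_eqF lti) eqxx.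
  case: eqP => [i23|_ /eqP //].
  by have := nopiv (@Ordinal 23 22 isT); rewrite -val_eqE /= pivE /= i23.
(* By reduced echelon form the pivot columns of [G] form the identity, so selecting them is a right
   inverse. *)
apply/eqP/row_freeP; exists (colsub piv 1%:M).
rewrite mulmx_colsub mulmx1; apply/matrixP => i j; rewrite !mxE !pivE.
have : (all (fun i : nat => all (fun j : nat =>
  let p k := if k == 22 then 23 else k in
  [&& p i <= p j & nth false (nth [::] generators (p i)) (p j - p i)] == (i == j))
  (iota 0 23)) (iota 0 23))%N by vm_compute.
move=> /allP /(_ i); rewrite mem_iota ltn_ord => /(_ isT).
move=> /allP /(_ j); rewrite mem_iota ltn_ord => /(_ isT) /eqP -> .
by rewrite val_eqE.
Qed.

Definition shift4 (i : 'I_108) : 'I_108 := inord ((i + 4) %% 108).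

Lemma bits_colsub_shift4 (x : 'rV['F_2]_108) :
  bits (colsub shift4 x) = rot 4 (bits x).
Proof.
apply: (@eq_from_nth _ false) => [|j]; first by rewrite size_rot !size_bits.
rewrite size_bits => ltj; rewrite (nth_bits _ (Ordinal ltj)) mxE.
rewrite -nth_bits inordK ?ltn_pmod //= /rot nth_cat size_drop size_bits.
case: ltnP => [ltj'|lej].
  by rewrite modn_small ?nth_drop 1?addnC //; lia.
have -> : (j + 4 = (j - 104) + 108)%N by lia.
by rewrite modnDr modn_small ?nth_take //; lia.
Qed.

Lemma colsub_shift4_code : (colsub shift4 code <= code)%MS.
Proof.
apply/row_subP => i.
have -> : row i (colsub shift4 code) = colsub shift4 (row i code).
  by apply/rowP => j; rewrite !mxE.
(* The encoding is systematic, so it suffices to re-encode the rotated row. *)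
set x := colsub _ _; suff -> : x = x *m code by exact: submxMl.
apply: (can_inj (@bitsK 108)).
rewrite bits_code /x bits_colsub_shift4 rowE bits_code.
have -> : bits (delta_mx 0 i : 'rV['F_2]_108) = mkseq (fun k => k == i) 108.
  apply: (@eq_from_nth _ false) => [|j]; first by rewrite size_bits size_mkseq.
  rewrite size_bits => ltj.
  by rewrite (nth_bits _ (Ordinal ltj)) mxE nth_mkseq // eqxx F2_natr_neq0.
have : all (fun i : nat =>
    let s := encode generators (mkseq (fun k => k == i) 108) [::] in
    rot 4 s == encode generators (rot 4 s) [::]) (iota 0 108) by vm_compute.
by move=> /allP /(_ i); rewrite mem_iota ltn_ord => /(_ isT) /eqP.
Qed.

Lemma rot_code (x : 'rV['F_2]_108) r : (r <= 27)%N ->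
  (x <= code)%MS -> (vec 108 (rot (4 * r) (bits x)) <= code)%MS.
Proof.
elim: r x => [|r IH] x le_r xC; first by rewrite muln0 rot0 bitsK.
rewrite mulnS addnC rotD ?size_bits; last by lia.
rewrite -bits_colsub_shift4 IH //; first exact: ltnW.
have /submxP[u ->] := xC; rewrite -mulmx_colsub.
exact: mulmx_sub colsub_shift4_code.
Qed.

(** * Minimum distance *)

Lemma code_min_weight (x : 'rV['F_2]_108) :
  (x <= code)%MS -> x != 0 -> (36 <= count id (bits x))%N.
Proof.
move=> xC; apply: contraNleq; rewrite ltnS => light.
have [r le_r] := within_light_rotation (size_bits x) light.
set w := rot _ _ => within_w.
have [u vec_w] := submxP (rot_code le_r xC).
have wE : w = encode generators (bits u) [::].
  by rewrite -bits_code -vec_w vecK // size_rot size_bits.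
(* The search starts with allowance 0 and its budget 35 is the sum of the gains, which forces weight
   0. *)
have : (count id w + 35 = 35)%N.
  have -> : 35%N = (0 + sumn gains)%N by vm_compute.
  rewrite wE in within_w *.
  by apply: searchP search_generators within_w.
rewrite (permP (permEl (perm_rot _ _))) => /eqP; rewrite -[X in _ == X]add0n eqn_add2r.
rewrite -leqn0 leqNgt -has_count => /hasPn no_one.
apply/eqP/rowP => i; rewrite mxE; apply/eqP; rewrite -[_ == _]negbK -nth_bits.
by apply: no_one; rewrite mem_nth // size_bits.
Qed.

Theorem theorem5p2 : exists C : 'M['F_2]_108, is_binary_linear_code 108 23 36 C.
Proof.
exists code; split; first exact: rank_code.
split=> [x y xC yC neq_xy|].
  by rewrite hamming_distE code_min_weight ?subr_eq0 // addmx_sub // eqmx_opp.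
pose m := rcons (nseq 10 false) true ++ nseq 97 false.
pose x : 'rV_108 := vec 108 m *m code.
have weight_x : count id (bits x) = 36%N.
  by rewrite bits_code vecK //; vm_compute.
have dist_x : hamming_dist x 0 = 36%N by rewrite hamming_distE subr0.
exists x, 0; split=> //; [exact: submxMl | exact: sub0mx |].
apply/eqP => x0; move: dist_x.
by rewrite x0 /hamming_dist eq_card0 // => i; rewrite inE eqxx.
Qed.
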